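(* Let $\mathcal{C} = (S_{\mathcal C}, \Sigma_{\mathcal C}, \mathit{next}_{\mathcal C}, \mathit{leak}_{\mathcal C})$ and $\mathcal{H} = (S_{\mathcal H}, \Sigma_{\mathcal H}, \mathit{next}_{\mathcal H}, \mathit{leak}_{\mathcal H})$ be two transition systems, and let $s_1, s_2 \in S_{\mathcal C}$ and $h_1, h_2 \in S_{\mathcal H}$. Suppose that $[\![ s_1 ]\!]_{\mathcal C} = [\![ s_2 ]\!]_{\mathcal C} \implies [\![ h_1 ]\!]_{\mathcal H} = [\![ h_2 ]\!]_{\mathcal H}$. Then the guarded judgment $\mathsf{Grd}(\emptyset; s_1, s_2, h_1, h_2)$ is derivable using only the rules C-Leak, C-Step, H-Step, Invariant, Cycle and Guard.
   Context: A transition system is a tuple $\mathcal T = (S, \Sigma, \mathit{next}, \mathit{leak})$, where $S$ is a set of states, $\Sigma$ is a set of observations, $\mathit{next} : S \to S$ is a transition function and $\mathit{leak} : S \to \Sigma$ is a leakage function. For $s \in S$, the infinite leakage trace $[\![ s ]\!]_{\mathcal T} \in \Sigma^\omega$ is the sequence $\mathit{leak}(s)\ \mathit{leak}(\mathit{next}(s))\ \mathit{leak}(\mathit{next}^2(s)) \ldots$, i.e. its $n$-th element is $\mathit{leak}(\mathit{next}^n(s))$. Judgments are of two kinds, guarded $\mathsf{Grd}(R; s_1,s_2,h_1,h_2)$ and unguarded $\mathsf{Ungrd}(R; s_1,s_2,h_1,h_2)$, where $s_1,s_2 \in S_{\mathcal C}$, $h_1,h_2 \in S_{\mathcal H}$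 and $R \subseteq S_{\mathcal C} \times S_{\mathcal C} \times S_{\mathcal H} \times S_{\mathcal H}$. (The paper writes them with a solid, respectively dashed, box around $R$.) Derivability is the (inductively generated) least family of judgments closed under the following rules, for all $s_1,s_2,h_1,h_2,R$ and all $R' \subseteq S_{\mathcal C} \times S_{\mathcal C} \times S_{\mathcal H} \times S_{\mathcal H}$: C-Leak: if $\mathit{leak}_{\mathcal C}(s_1) \neq \mathit{leak}_{\mathcal C}(s_2)$, infer $\mathsf{Grd}(R; s_1, s_2, h_1, h_2)$. C-Step: from $\mathsf{Grd}(R; \mathit{next}_{\mathcal C}(s_1), \mathit{next}_{\mathcal C}(s_2), h_1, h_2)$ infer $\mathsf{Grd}(R; s_1, s_2, h_1, h_2)$. H-Step: if $\mathit{leak}_{\mathcal H}(h_1) = \mathit{leak}_{\mathcal H}(h_2)$, from $\mathsf{Ungrd}(R; s_1, s_2, \mathit{next}_{\mathcal H}(h_1), \mathit{next}_{\mathcal H}(h_2))$ infer $\mathsf{Grd}(R; s_1, s_2, h_1, h_2)$. Invariant: if $(s_1, s_2, h_1, h_2) \in R'$, from the family of premises $\mathsf{Grd}(R \cup R'; s'_1, s'_2, h'_1, h'_2)$ for all $(s'_1, s'_2, h'_1, h'_2) \in R'$ infer $\mathsf{Grd}(R; s_1, s_2, h_1, h_2)$. Cycle: if $(s_1, s_2, h_1, h_2) \in R$, infer $\mathsf{Ungrd}(R; s_1, s_2, h_1, h_2)$. Guard: from $\mathsf{Grd}(R; s_1, s_2, h_1, h_2)$ infer $\mathsf{Ungrd}(R;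 s_1, s_2, h_1, h_2)$. *)

(* Defs.v *)
From mathcomp Require Import all_boot.
From mathcomp Require Import classical_sets.

Set Implicit Arguments.
Unset Strict Implicit.
Unset Printing Implicit Defensive.

Local Open Scope classical_set_scope.

Record transition_system := TransitionSystem {
  state : Type;
  obs : Type;
  next : state -> state;
  leak : state -> obs }.

Arguments next : clear implicits.
Arguments leak : clear implicits.

(* Infinite words over [obs T] are functions from [nat]. *)
Definition trace (T : transition_system) (s : state T) : nat -> obs T :=
  fun n => leak T (iter n (next T) s).

Definition quad (C H : transition_system) : Type :=
  (state C * state C * state H * state H)%type.

(* The set R is an index, not a parameter: the rule Invariant enlarges it. *)
Inductive Grd (C H : transition_system) :
    set (quad C H) -> state C -> state C -> state H -> state H -> Prop :=
| C_Leak R s1 s2 h1 h2 :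
    leak C s1 <> leak C s2 ->
    Grd R s1 s2 h1 h2
| C_Step R s1 s2 h1 h2 :
    Grd R (next C s1) (next C s2) h1 h2 ->
    Grd R s1 s2 h1 h2
| H_Step R s1 s2 h1 h2 :
    leak H h1 = leak H h2 ->
    Ungrd R s1 s2 (next H h1) (next H h2) ->
    Grd R s1 s2 h1 h2
| Invariant (R R' : set (quad C H)) s1 s2 h1 h2 :
    R' (s1, s2, h1, h2) ->
    (forall s1' s2' h1' h2',
       R' (s1', s2', h1', h2') -> Grd (R `|` R') s1' s2' h1' h2') ->
    Grd R s1 s2 h1 h2
with Ungrd (C H : transition_system) :
    set (quad C H) -> state C -> state C -> state H -> state H -> Prop :=
| Cycle (R : set (quad C H)) s1 s2 h1 h2 :
    R (s1, s2, h1, h2) ->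
    Ungrd R s1 s2 h1 h2
| Guard R s1 s2 h1 h2 :
    Grd R s1 s2 h1 h2 ->
    Ungrd R s1 s2 h1 h2.

(* Main.v *)
(* If the C-traces differ at some index, step C up to it and apply C-Leak.
   Otherwise the H-traces agree, and the pairs of H-states reachable in lockstep
   form an invariant: each H-Step closes at once with Cycle. *)
Require Import Defs.
From mathcomp Require Import all_boot.
From mathcomp Require Import boolp classical_sets.

Lemma Grd_of_leak_neq (C H : transition_system) (R : set (quad C H)) n
    (s1 s2 : state C) (h1 h2 : state H) :
  trace s1 n <> trace s2 n -> Grd R s1 s2 h1 h2.
Proof.
elim: n s1 s2 => [|n IHn] s1 s2; first exact: C_Leak.
(* [iterSr] peels the step off at the start state, so index [n.+1] from [s1], [s2] becomes index [n]
   from their successors, as [C_Step] requires. *)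
by rewrite /trace !iterSr => neq; apply: C_Step; apply: IHn.
Qed.

Lemma Grd_of_trace_eq (C H : transition_system) (R : set (quad C H))
    (s1 s2 : state C) (h1 h2 : state H) :
  trace h1 = trace h2 -> Grd R s1 s2 h1 h2.
Proof.
move=> eqh.
(* The C-states stay frozen: only H moves in this derivation. *)
pose orbit : set (quad C H) := fun q =>
  exists n, q = (s1, s2, iter n (Defs.next H) h1, iter n (Defs.next H) h2).
apply: (@Invariant _ _ _ orbit); first by exists 0.
move=> _ _ _ _ [n [-> -> -> ->]].
apply: H_Step; first exact: (congr1 (@^~ n) eqh).
(* [Invariant] has added [orbit] as the right half of the union; [iter n.+1] unfolds to one more
   step after [iter n]. *)
by apply: Cycle; right; exists n.+1.
Qed.

Theorem theorem17 (C H : transition_system)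
    (s1 s2 : state C) (h1 h2 : state H) :
  (trace s1 = trace s2 -> trace h1 = trace h2) ->
  Grd (@set0 (quad C H)) s1 s2 h1 h2.
Proof.
move=> imp.
have [eqs|neqs] := pselect (trace s1 = trace s2).
  exact: Grd_of_trace_eq (imp eqs).
have [n neq] : exists n, trace s1 n <> trace s2 n.
  by apply/existsNP => eqs; apply: neqs; apply/funext.
exact: Grd_of_leak_neq neq.
Qed.
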